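(* (i) The group $\mathrm{N}(L_{m,2})$, $m\ge 3$, is abelian. (ii) The group $\mathrm{N}(L_{m,3})$, $m\ge 3$, is nilpotent of class $2$. (iii) The group $\mathrm{N}(L_{m,c})$, where $m\ge 2$, $c\ge 4$ or $(m,c)=(2,2)$, is metabelian. (iv) The group $\mathrm{N}(L_{2,3})$ is (nilpotent of class two)-by-abelian, i.e. $\mathrm{N}(L_{2,3})\in\mathfrak{N}_2\mathfrak{A}$.
   Context: $K$ is a field of characteristic $0$. $L_m$ is the free Lie algebra over $K$ with free generators $y_1,\ldots,y_m$, and $L_{m,c}=L_m/(L_m''+L_m^{c+1})$ is the free $m$-generated metabelian nilpotent of class $c$ Lie algebra, where $L_m''=[[L_m,L_m],[L_m,L_m]]$ and $L_m^{k}$ is the $k$-th term of the lower central series ($L_m^1=L_m$). $\mathrm{N}(L_{m,c})$ is the group of normal automorphisms of $L_{m,c}$, i.e. automorphisms $\varphi$ with $\varphi(I)=I$ for every ideal $I$ of $L_{m,c}$. A group is metabelian if its commutator subgroup is abelian. $\mathfrak{N}_2\mathfrak{A}$ is the class of groups having a normal subgroup which is nilpotent of class at most two with abelian quotient. *)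

(* Defs.v *)
From HB Require Import structures.
From mathcomp Require Import all_boot all_order all_algebra.
From mathcomp Require Import boolp classical_sets.

Set Implicit Arguments.
Unset Strict Implicit.
Unset Printing Implicit Defensive.

Import GRing.Theory.
Local Open Scope classical_set_scope.
Local Open Scope ring_scope.

HB.mixin Record Lmodule_isLieAlgebra (K : fieldType) L of GRing.Lmodule K L := {
  lie : L -> L -> L;
  lie_linearl : forall y : L, linear (fun x => lie x y);
  lie_linearr : forall x : L, linear (lie x);
  lie_alt : forall x : L, lie x x = 0;
  lie_jacobi : forall x y z : L,
    lie x (lie y z) + lie y (lie z x) + lie z (lie x y) = 0
}.

#[short(type="lieAlgType")]
HB.structure Definition LieAlgebra (K : fieldType) :=
  {L of GRing.Lmodule K L & Lmodule_isLieAlgebra K L}.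

Notation "[ 'lie' x , y ]" := (lie x y)
  (at level 0, x, y at level 99, format "[ 'lie'  x ,  y ]") : ring_scope.

Section LieTheory.
Variables (K : fieldType) (L : lieAlgType K).
Implicit Types x y z : L.

Lemma lieDl x y z : [lie x + y, z] = [lie x, z] + [lie y, z].
Proof. by have := lie_linearl z 1 x y; rewrite !scale1r. Qed.

Lemma lieDr x y z : [lie x, y + z] = [lie x, y] + [lie x, z].
Proof. by have := lie_linearr x 1 y z; rewrite !scale1r. Qed.

Lemma lie0l x : [lie 0, x] = 0.
Proof. by apply: (addIr [lie 0, x]); rewrite -lieDl !add0r. Qed.

Lemma lie0r x : [lie x, 0] = 0.
Proof. by apply: (addIr [lie x, 0]); rewrite -lieDr !add0r. Qed.

Lemma lieZl a x y : [lie a *: x, y] = a *: [lie x, y].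
Proof. by have := lie_linearl y a x 0; rewrite !addr0 lie0l addr0. Qed.

Lemma lieZr a x y : [lie x, a *: y] = a *: [lie x, y].
Proof. by have := lie_linearr x a y 0; rewrite !addr0 lie0r addr0. Qed.

Lemma lieNl x y : [lie - x, y] = - [lie x, y].
Proof. by rewrite -scaleN1r lieZl scaleN1r. Qed.

Lemma lieNr x y : [lie x, - y] = - [lie x, y].
Proof. by rewrite -scaleN1r lieZr scaleN1r. Qed.

Lemma lieC x y : [lie x, y] = - [lie y, x].
Proof.
apply/eqP; rewrite -addr_eq0; apply/eqP.
by have := lie_alt (x + y); rewrite lieDl !lieDr !lie_alt add0r addr0.
Qed.

Definition is_subspace (A : set L) : Prop :=
  A 0 /\ forall (a : K) x y, A x -> A y -> A (a *: x + y).

(* By anticommutativity such a right ideal is two-sided. *)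
Definition is_lie_ideal (I : set L) : Prop :=
  is_subspace I /\ forall x y, I x -> I [lie x, y].

Definition lie_prod (A B : set L) : set L :=
  smallest is_subspace [set [lie x, y] | x in A & y in B].

Definition lie_derived : set L := lie_prod setT setT.

Definition lie_derived2 : set L := lie_prod lie_derived lie_derived.

(* The indexing is 1-based: lie_lcs 1 = L and lie_lcs k.+2 = [lie_lcs k.+1, L];
   the value at 0, also L, is irrelevant. *)
Definition lie_lcs (k : nat) : set L :=
  iter k.-1 (fun A => lie_prod A setT) setT.

Definition set_add (A B : set L) : set L := [set x + y | x in A & y in B].

Record lie_ideal := LieIdeal {
  ideal_set :> set L;
  lie_idealP : is_lie_ideal ideal_set
}.

Lemma subspaceD (A : set L) x y : is_subspace A -> A x -> A y -> A (x + y).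
Proof. by move=> [_ sA] Ax Ay; have := sA 1 _ _ Ax Ay; rewrite scale1r. Qed.

Lemma subspaceZ (A : set L) a x : is_subspace A -> A x -> A (a *: x).
Proof. by move=> [A0 sA] Ax; have := sA a _ _ Ax A0; rewrite addr0. Qed.

Lemma subspaceN (A : set L) x : is_subspace A -> A x -> A (- x).
Proof. by move=> sA Ax; rewrite -scaleN1r; apply: subspaceZ. Qed.

Lemma is_lie_idealT : is_lie_ideal setT.
Proof. by []. Qed.

Lemma lie_prod_subspace A B : is_subspace (lie_prod A B).
Proof.
split=> [S [[S0 _] _] //|a x y Ax Ay S [sS sub]].
by apply: sS.2; [apply: Ax|apply: Ay].
Qed.

Lemma lie_prod_ideal A B :
  is_lie_ideal A -> is_lie_ideal B -> is_lie_ideal (lie_prod A B).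
Proof.
move=> [sA iA] [sB iB]; split; first exact: lie_prod_subspace.
move=> x z xAB.
apply: (xAB [set w | lie_prod A B [lie w, z]]); split; first split=> /=.
- by rewrite lie0l; apply: (lie_prod_subspace A B).1.
- move=> a u v Pu Pv; rewrite lieDl lieZl.
  exact: (lie_prod_subspace A B).2.
move=> _ [a Aa [b Bb <-]] /=.
have -> : [lie [lie a, b], z] = [lie a, [lie b, z]] + [lie [lie a, z], b].
  have := lie_jacobi a b z; rewrite (lieC z [lie a, b]) => /eqP.
  rewrite subr_eq0 => /eqP <-.
  by rewrite (lieC z a) lieNr (lieC b [lie a, z]) opprK.
apply: (subspaceD (lie_prod_subspace A B)).
  by apply: sub_gen_smallest; exists a => //; exists [lie b, z] => //; apply: iB.
by apply: sub_gen_smallest; exists [lie a, z]; [apply: iA|exists b].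
Qed.

Lemma lie_lcs_ideal k : is_lie_ideal (lie_lcs k).
Proof.
rewrite /lie_lcs; elim: k.-1 => [|n IHn] /=; first exact: is_lie_idealT.
by apply: lie_prod_ideal => //; apply: is_lie_idealT.
Qed.

Lemma set_add_ideal A B :
  is_lie_ideal A -> is_lie_ideal B -> is_lie_ideal (set_add A B).
Proof.
move=> [sA iA] [sB iB]; split; first split.
- by exists 0; [apply: sA.1|exists 0; [apply: sB.1|rewrite addr0]].
- move=> a _ _ [x Ax [y By <-]] [x' Ax' [y' By' <-]].
  exists (a *: x + x'); first exact: sA.2.
  by exists (a *: y + y'); [exact: sB.2|rewrite scalerDr addrACA].
move=> _ z [x Ax [y By <-]]; rewrite lieDl.
by exists [lie x, z]; [apply: iA|exists [lie y, z] => //; apply: iB].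
Qed.

Definition metab_nil_ideal (c : nat) : lie_ideal :=
  LieIdeal
    (set_add_ideal
       (lie_prod_ideal (lie_prod_ideal is_lie_idealT is_lie_idealT)
                       (lie_prod_ideal is_lie_idealT is_lie_idealT))
       (lie_lcs_ideal c.+1)).

Lemma metab_nil_idealE c :
  metab_nil_ideal c = set_add lie_derived2 (lie_lcs c.+1) :> set L.
Proof. by []. Qed.

End LieTheory.

Arguments lie_derived {K} L.
Arguments lie_derived2 {K} L.
Arguments lie_lcs {K} L k.
Arguments metab_nil_ideal {K} L c.

Definition lie_morphism (K : fieldType) (L M : lieAlgType K) (f : L -> M) : Prop :=
  linear f /\ {morph f : x y / [lie x, y]}.

Section Quotient.
Variables (K : fieldType) (L : lieAlgType K) (I : lie_ideal L).
Local Open Scope quotient_scope.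

Definition ideal_eq : rel L := fun x y => `[< ideal_set I (x - y) >].

Let sI := (lie_idealP I).1.

Lemma ideal_eq_equiv : equiv_class_of ideal_eq.
Proof.
split=> [x|x y|y x z]; rewrite /ideal_eq.
- by apply/asboolP; rewrite subrr; apply: sI.1.
- by apply/asboolP/asboolP => ?; rewrite -opprB; apply: (subspaceN sI).
move=> /asboolP xy /asboolP yz; apply/asboolP.
by rewrite -[x](subrK y) -addrA; apply: (subspaceD sI).
Qed.

Canonical ideal_eq_rel := EquivRelPack ideal_eq_equiv.

Definition lie_quot : Type := {eq_quot ideal_eq_rel}.
HB.instance Definition _ := EqQuotient.on lie_quot.
HB.instance Definition _ := Choice.on lie_quot.

Definition quot_proj (x : L) : lie_quot := \pi x.

Lemma quot_projP x y : quot_proj x = quot_proj y <-> ideal_set I (x - y).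
Proof.
split=> [/eqmodP /asboolP //|Ixy].
by apply/eqmodP/asboolP.
Qed.

Lemma quot_proj_surj (u : lie_quot) : exists x, u = quot_proj x.
Proof. by exists (repr u); rewrite /quot_proj reprK. Qed.

Let rep (x : L) : ideal_set I (repr (quot_proj x) - x).
Proof. by apply/quot_projP; rewrite /quot_proj reprK. Qed.

Definition quot_zero : lie_quot := quot_proj 0.
Definition quot_add (u v : lie_quot) : lie_quot := quot_proj (repr u + repr v).
Definition quot_opp (u : lie_quot) : lie_quot := quot_proj (- repr u).
Definition quot_scale (a : K) (u : lie_quot) : lie_quot :=
  quot_proj (a *: repr u).
Definition quot_lie (u v : lie_quot) : lie_quot :=
  quot_proj [lie repr u, repr v].

Lemma quot_addE x y : quot_add (quot_proj x) (quot_proj y) = quot_proj (x + y).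
Proof. by apply/quot_projP; rewrite opprD addrACA; apply: subspaceD. Qed.

Lemma quot_oppE x : quot_opp (quot_proj x) = quot_proj (- x).
Proof. by apply/quot_projP; rewrite -opprD; apply: subspaceN. Qed.

Lemma quot_scaleE a x : quot_scale a (quot_proj x) = quot_proj (a *: x).
Proof. by apply/quot_projP; rewrite -scalerBr; apply: subspaceZ. Qed.

Lemma quot_lieE x y : quot_lie (quot_proj x) (quot_proj y) = quot_proj [lie x, y].
Proof.
apply/quot_projP; set x' := repr _; set y' := repr _.
have -> : [lie x', y'] - [lie x, y] = [lie x' - x, y'] - [lie y' - y, x].
  rewrite (lieC (y' - y)) opprK lieDl lieNl lieDr lieNr.
  by rewrite addrA subrK.
apply: subspaceD => //; first by apply: (lie_idealP I).2; apply: rep.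
by apply: subspaceN => //; apply: (lie_idealP I).2; apply: rep.
Qed.

Let qE := (quot_addE, quot_oppE, quot_scaleE, quot_lieE).

Lemma quot_addA : associative quot_add.
Proof.
move=> u v w; have [[x ->] [y ->] [z ->]] :=
  And3 (quot_proj_surj u) (quot_proj_surj v) (quot_proj_surj w).
by rewrite !qE addrA.
Qed.

Lemma quot_addC : commutative quot_add.
Proof. by move=> u v; rewrite /quot_add addrC. Qed.

Lemma quot_add0 : left_id quot_zero quot_add.
Proof.
by move=> u; have [x ->] := quot_proj_surj u; rewrite /quot_zero !qE add0r.
Qed.

Lemma quot_addN : left_inverse quot_zero quot_opp quot_add.
Proof. by move=> u; have [x ->] := quot_proj_surj u; rewrite !qE addNr. Qed.

HB.instance Definition _ :=
  GRing.isZmodule.Build lie_quot quot_addA quot_addC quot_add0 quot_addN.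

Lemma quot_projD x y : quot_proj (x + y) = quot_proj x + quot_proj y.
Proof. by rewrite -quot_addE. Qed.

Lemma quot_scaleA a b u : quot_scale a (quot_scale b u) = quot_scale (a * b) u.
Proof. by have [x ->] := quot_proj_surj u; rewrite !qE scalerA. Qed.

Lemma quot_scale1 : left_id 1 quot_scale.
Proof. by move=> u; have [x ->] := quot_proj_surj u; rewrite !qE scale1r. Qed.

Lemma quot_scaleDr : right_distributive quot_scale +%R.
Proof.
move=> a u v; have [x ->] := quot_proj_surj u; have [y ->] := quot_proj_surj v.
by rewrite -quot_projD !qE scalerDr quot_projD.
Qed.

Lemma quot_scaleDl u : {morph quot_scale^~ u : a b / a + b}.
Proof.
by move=> a b /=; have [x ->] := quot_proj_surj u; rewrite !qE scalerDl quot_projD.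
Qed.

HB.instance Definition _ := GRing.Zmodule_isLmodule.Build K lie_quot
  quot_scaleA quot_scale1 quot_scaleDr quot_scaleDl.

Lemma quot_projZ a x : quot_proj (a *: x) = a *: quot_proj x.
Proof. by rewrite -quot_scaleE. Qed.

Lemma quot_lie_linearl v : linear (fun u => quot_lie u v).
Proof.
move=> a u w; have [[x ->] [y ->] [z ->]] :=
  And3 (quot_proj_surj u) (quot_proj_surj v) (quot_proj_surj w).
by rewrite -quot_projZ -quot_projD !qE lieDl lieZl quot_projD quot_projZ.
Qed.

Lemma quot_lie_linearr u : linear (quot_lie u).
Proof.
move=> a v w; have [[x ->] [y ->] [z ->]] :=
  And3 (quot_proj_surj u) (quot_proj_surj v) (quot_proj_surj w).
by rewrite -quot_projZ -quot_projD !qE lieDr lieZr quot_projD quot_projZ.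
Qed.

Lemma quot_lie_alt u : quot_lie u u = 0.
Proof. by have [x ->] := quot_proj_surj u; rewrite qE lie_alt. Qed.

Lemma quot_lie_jacobi u v w :
  quot_lie u (quot_lie v w) + quot_lie v (quot_lie w u)
    + quot_lie w (quot_lie u v) = 0.
Proof.
have [[x ->] [y ->] [z ->]] :=
  And3 (quot_proj_surj u) (quot_proj_surj v) (quot_proj_surj w).
by rewrite !qE -!quot_projD lie_jacobi.
Qed.

HB.instance Definition _ := Lmodule_isLieAlgebra.Build K lie_quot
  quot_lie_linearl quot_lie_linearr quot_lie_alt quot_lie_jacobi.

Lemma quot_proj_morphism : lie_morphism quot_proj.
Proof.
split=> [a x y|x y]; first by rewrite quot_projD quot_projZ.
by rewrite -quot_lieE.
Qed.

End Quotient.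

Section FreeLie.
Variables (K : fieldType) (m : nat).
Local Open Scope quotient_scope.

Inductive lie_term : Type :=
  | TVar of 'I_m
  | TZero
  | TAdd of lie_term & lie_term
  | TOpp of lie_term
  | TScale of K & lie_term
  | TLie of lie_term & lie_term.

(* The congruence on terms generated by the axioms of Lie algebras over K. *)
Inductive term_eq : lie_term -> lie_term -> Prop :=
  | teq_refl t : term_eq t t
  | teq_sym t u : term_eq t u -> term_eq u t
  | teq_trans t u v : term_eq t u -> term_eq u v -> term_eq t v
  | teq_add t t' u u' :
      term_eq t t' -> term_eq u u' -> term_eq (TAdd t u) (TAdd t' u')
  | teq_opp t t' : term_eq t t' -> term_eq (TOpp t) (TOpp t')
  | teq_scale a t t' : term_eq t t' -> term_eq (TScale a t) (TScale a t')
  | teq_lie t t' u u' :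
      term_eq t t' -> term_eq u u' -> term_eq (TLie t u) (TLie t' u')
  | teq_addA t u v : term_eq (TAdd t (TAdd u v)) (TAdd (TAdd t u) v)
  | teq_addC t u : term_eq (TAdd t u) (TAdd u t)
  | teq_add0 t : term_eq (TAdd TZero t) t
  | teq_addN t : term_eq (TAdd (TOpp t) t) TZero
  | teq_scaleA a b t : term_eq (TScale a (TScale b t)) (TScale (a * b) t)
  | teq_scale1 t : term_eq (TScale 1 t) t
  | teq_scaleDr a t u :
      term_eq (TScale a (TAdd t u)) (TAdd (TScale a t) (TScale a u))
  | teq_scaleDl a b t :
      term_eq (TScale (a + b) t) (TAdd (TScale a t) (TScale b t))
  | teq_lie_linearl a t u v :
      term_eq (TLie (TAdd (TScale a t) u) v) (TAdd (TScale a (TLie t v)) (TLie u v))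
  | teq_lie_linearr a t u v :
      term_eq (TLie v (TAdd (TScale a t) u)) (TAdd (TScale a (TLie v t)) (TLie v u))
  | teq_lie_alt t : term_eq (TLie t t) TZero
  | teq_lie_jacobi t u v :
      term_eq (TAdd (TAdd (TLie t (TLie u v)) (TLie u (TLie v t)))
                    (TLie v (TLie t u)))
              TZero.

HB.instance Definition _ := gen_eqMixin lie_term.
HB.instance Definition _ := gen_choiceMixin lie_term.

Definition term_eqb : rel lie_term := fun t u => `[< term_eq t u >].

Lemma term_eqb_equiv : equiv_class_of term_eqb.
Proof.
split=> [t|t u|u t v]; rewrite /term_eqb.
- by apply/asboolP; apply: teq_refl.
- by apply/asboolP/asboolP; apply: teq_sym.
by move=> /asboolP tu /asboolP uv; apply/asboolP; apply: teq_trans uv.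
Qed.

Canonical term_eq_rel := EquivRelPack term_eqb_equiv.

Definition free_lie : Type := {eq_quot term_eq_rel}.
HB.instance Definition _ := EqQuotient.on free_lie.
HB.instance Definition _ := Choice.on free_lie.

Definition term_class (t : lie_term) : free_lie := \pi t.

Lemma term_classP t u : term_class t = term_class u <-> term_eq t u.
Proof.
split=> [/eqmodP /asboolP //|tu].
by apply/eqmodP/asboolP.
Qed.

Lemma term_class_surj (x : free_lie) : exists t, x = term_class t.
Proof. by exists (repr x); rewrite /term_class reprK. Qed.

Let rep t : term_eq (repr (term_class t)) t.
Proof. by apply/term_classP; rewrite /term_class reprK. Qed.

Definition free_zero : free_lie := term_class TZero.
Definition free_add (x y : free_lie) : free_lie :=
  term_class (TAdd (repr x) (repr y)).
Definition free_opp (x : free_lie) : free_lie := term_class (TOpp (repr x)).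
Definition free_scale (a : K) (x : free_lie) : free_lie :=
  term_class (TScale a (repr x)).
Definition free_br (x y : free_lie) : free_lie :=
  term_class (TLie (repr x) (repr y)).

Lemma free_addE t u :
  free_add (term_class t) (term_class u) = term_class (TAdd t u).
Proof. by apply/term_classP; apply: teq_add. Qed.

Lemma free_oppE t : free_opp (term_class t) = term_class (TOpp t).
Proof. by apply/term_classP; apply: teq_opp. Qed.

Lemma free_scaleE a t : free_scale a (term_class t) = term_class (TScale a t).
Proof. by apply/term_classP; apply: teq_scale. Qed.

Lemma free_brE t u : free_br (term_class t) (term_class u) = term_class (TLie t u).
Proof. by apply/term_classP; apply: teq_lie. Qed.

Let fE := (free_addE, free_oppE, free_scaleE, free_brE).

Lemma free_addA : associative free_add.
Proof.
move=> x y z; have [[t ->] [u ->] [v ->]] :=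
  And3 (term_class_surj x) (term_class_surj y) (term_class_surj z).
by rewrite !fE; apply/term_classP; apply: teq_addA.
Qed.

Lemma free_addC : commutative free_add.
Proof. by move=> x y; apply/term_classP; apply: teq_addC. Qed.

Lemma free_add0 : left_id free_zero free_add.
Proof.
move=> x; have [t ->] := term_class_surj x.
by rewrite /free_zero !fE; apply/term_classP; apply: teq_add0.
Qed.

Lemma free_addN : left_inverse free_zero free_opp free_add.
Proof.
move=> x; have [t ->] := term_class_surj x.
by rewrite !fE; apply/term_classP; apply: teq_addN.
Qed.

HB.instance Definition _ :=
  GRing.isZmodule.Build free_lie free_addA free_addC free_add0 free_addN.

Lemma term_classD t u : term_class (TAdd t u) = term_class t + term_class u.
Proof. by rewrite -free_addE. Qed.

Lemma free_scaleA a b x : free_scale a (free_scale b x) = free_scale (a * b) x.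
Proof.
have [t ->] := term_class_surj x.
by rewrite !fE; apply/term_classP; apply: teq_scaleA.
Qed.

Lemma free_scale1 : left_id 1 free_scale.
Proof.
move=> x; have [t ->] := term_class_surj x.
by rewrite !fE; apply/term_classP; apply: teq_scale1.
Qed.

Lemma free_scaleDr : right_distributive free_scale +%R.
Proof.
move=> a x y; have [t ->] := term_class_surj x; have [u ->] := term_class_surj y.
by rewrite -term_classD !fE -term_classD; apply/term_classP; apply: teq_scaleDr.
Qed.

Lemma free_scaleDl x : {morph free_scale^~ x : a b / a + b}.
Proof.
move=> a b /=; have [t ->] := term_class_surj x.
by rewrite !fE -term_classD; apply/term_classP; apply: teq_scaleDl.
Qed.

HB.instance Definition _ := GRing.Zmodule_isLmodule.Build K free_lie
  free_scaleA free_scale1 free_scaleDr free_scaleDl.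

Lemma term_classZ a t : term_class (TScale a t) = a *: term_class t.
Proof. by rewrite -free_scaleE. Qed.

Lemma free_br_linearl y : linear (fun x => free_br x y).
Proof.
move=> a x z; have [[t ->] [u ->] [v ->]] :=
  And3 (term_class_surj x) (term_class_surj y) (term_class_surj z).
rewrite -term_classZ -term_classD !fE -term_classZ -term_classD.
by apply/term_classP; apply: teq_lie_linearl.
Qed.

Lemma free_br_linearr x : linear (free_br x).
Proof.
move=> a y z; have [[t ->] [u ->] [v ->]] :=
  And3 (term_class_surj x) (term_class_surj y) (term_class_surj z).
rewrite -term_classZ -term_classD !fE -term_classZ -term_classD.
by apply/term_classP; apply: teq_lie_linearr.
Qed.

Lemma free_br_alt x : free_br x x = 0.
Proof.
have [t ->] := term_class_surj x.
by rewrite fE; apply/term_classP; apply: teq_lie_alt.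
Qed.

Lemma free_br_jacobi x y z :
  free_br x (free_br y z) + free_br y (free_br z x) + free_br z (free_br x y) = 0.
Proof.
have [[t ->] [u ->] [v ->]] :=
  And3 (term_class_surj x) (term_class_surj y) (term_class_surj z).
rewrite !fE -!term_classD.
by apply/term_classP; apply: teq_lie_jacobi.
Qed.

HB.instance Definition _ := Lmodule_isLieAlgebra.Build K free_lie
  free_br_linearl free_br_linearr free_br_alt free_br_jacobi.

Lemma term_class_lie t u :
  term_class (TLie t u) = [lie term_class t, term_class u].
Proof. by rewrite -free_brE. Qed.

Lemma term_classN t : term_class (TOpp t) = - term_class t.
Proof. by rewrite -free_oppE. Qed.

Definition free_gen (i : 'I_m) : free_lie := term_class (TVar i).

Section Lift.
Variables (M : lieAlgType K) (h : 'I_m -> M).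

Fixpoint term_eval (t : lie_term) : M :=
  match t with
  | TVar i => h i
  | TZero => 0
  | TAdd t u => term_eval t + term_eval u
  | TOpp t => - term_eval t
  | TScale a t => a *: term_eval t
  | TLie t u => [lie term_eval t, term_eval u]
  end.

Lemma term_eval_eq t u : term_eq t u -> term_eval t = term_eval u.
Proof.
elim=> //=.
- by move=> ? ? ? _ -> _ ->.
- by move=> ? ? ? ? _ -> _ ->.
- by move=> ? ? _ ->.
- by move=> ? ? ? _ ->.
- by move=> ? ? ? ? _ -> _ ->.
- by move=> *; rewrite addrA.
- by move=> *; rewrite addrC.
- by move=> *; rewrite add0r.
- by move=> *; rewrite addNr.
- by move=> *; rewrite scalerA.
- by move=> *; rewrite scale1r.
- by move=> *; rewrite scalerDr.
- by move=> *; rewrite scalerDl.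
- by move=> *; rewrite lieDl lieZl.
- by move=> *; rewrite lieDr lieZr.
- by move=> *; rewrite lie_alt.
- by move=> *; rewrite lie_jacobi.
Qed.

Definition free_lift (x : free_lie) : M := term_eval (repr x).

Lemma free_liftE t : free_lift (term_class t) = term_eval t.
Proof. exact/term_eval_eq. Qed.

Lemma free_lift_gen i : free_lift (free_gen i) = h i.
Proof. by rewrite free_liftE. Qed.

Lemma free_lift_morphism : lie_morphism free_lift.
Proof.
split=> [a x y|x y];
  have [t ->] := term_class_surj x; have [u ->] := term_class_surj y.
  by rewrite -term_classZ -term_classD !free_liftE.
by rewrite -term_class_lie !free_liftE.
Qed.

Lemma free_lift_unique (f : free_lie -> M) :
  lie_morphism f -> (forall i, f (free_gen i) = h i) -> f =1 free_lift.
Proof.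
move=> [f_lin f_lie] fh.
have f0 : f 0 = 0.
  by have := f_lin (-1) 0 0; rewrite !scaleN1r !addNr.
have fD x y : f (x + y) = f x + f y.
  by have := f_lin 1 x y; rewrite !scale1r.
have fZ a x : f (a *: x) = a *: f x.
  by have := f_lin a x 0; rewrite !addr0 f0 addr0.
move=> x; have [t ->] := term_class_surj x; rewrite free_liftE.
elim: t => [i||t IHt u IHu|t IHt|a t IHt|t IHt u IHu] /=.
- exact: fh.
- exact: f0.
- by rewrite term_classD fD IHt IHu.
- by rewrite term_classN -scaleN1r fZ IHt scaleN1r.
- by rewrite term_classZ fZ IHt.
- by rewrite term_class_lie f_lie IHt IHu.
Qed.

End Lift.
End FreeLie.

Arguments free_gen K {m} i.

Definition free_metab_nil (K : fieldType) (m c : nat) : lieAlgType K :=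
  lie_quot (metab_nil_ideal (free_lie K m) c).

Section Automorphisms.
Variables (K : fieldType) (L : lieAlgType K).

Definition is_lie_aut (f : L -> L) : Prop := lie_morphism f /\ bijective f.

Record lie_aut := LieAut {
  aut_fun :> L -> L;
  aut_funP : `[< is_lie_aut aut_fun >]
}.

HB.instance Definition _ := [isSub for aut_fun].
HB.instance Definition _ := [Choice of lie_aut by <:].

Lemma lie_autP (f : lie_aut) : is_lie_aut f.
Proof. exact/asboolP/aut_funP. Qed.

Lemma lie_aut_eq (f g : lie_aut) : f =1 g -> f = g.
Proof. by move=> /funext fg; apply: val_inj. Qed.

Lemma is_lie_aut1 : is_lie_aut id.
Proof. by split; [split|exists id]. Qed.

Lemma is_lie_autM (f g : lie_aut) : is_lie_aut (f \o g).
Proof.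
have [[f_lin f_lie] f_bij] := lie_autP f; have [[g_lin g_lie] g_bij] := lie_autP g.
split; last exact: bij_comp.
by split=> [a x y|x y] /=; rewrite ?g_lin ?f_lin // g_lie f_lie.
Qed.

Lemma aut_inv_exists (f : lie_aut) : exists g : L -> L, cancel f g /\ cancel g f.
Proof. by have [_ [g fK gK]] := lie_autP f; exists g. Qed.

Definition aut_inv (f : lie_aut) : L -> L := sval (cid (aut_inv_exists f)).

Lemma aut_invK (f : lie_aut) : cancel f (aut_inv f).
Proof. by rewrite /aut_inv; case: cid => g []. Qed.

Lemma autK (f : lie_aut) : cancel (aut_inv f) f.
Proof. by rewrite /aut_inv; case: cid => g []. Qed.

Lemma is_lie_autV (f : lie_aut) : is_lie_aut (aut_inv f).
Proof.
have [[f_lin f_lie] f_bij] := lie_autP f.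
split; last by exists f; [apply: autK|apply: aut_invK].
split=> [a x y|x y]; apply: (bij_inj f_bij).
  by rewrite f_lin !autK.
by rewrite f_lie !autK.
Qed.

Definition aut_one : lie_aut := LieAut (asboolT is_lie_aut1).
Definition aut_mul (f g : lie_aut) : lie_aut := LieAut (asboolT (is_lie_autM f g)).
Definition aut_invg (f : lie_aut) : lie_aut := LieAut (asboolT (is_lie_autV f)).

Lemma aut_mulA : associative aut_mul.
Proof. by move=> f g h; apply: lie_aut_eq. Qed.

Lemma aut_mul1 : left_id aut_one aut_mul.
Proof. by move=> f; apply: lie_aut_eq. Qed.

Lemma aut_mulr1 : right_id aut_one aut_mul.
Proof. by move=> f; apply: lie_aut_eq. Qed.

Lemma aut_mulV : left_inverse aut_one aut_invg aut_mul.
Proof. by move=> f; apply: lie_aut_eq => x /=; apply: aut_invK. Qed.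

Lemma aut_mulrV : right_inverse aut_one aut_invg aut_mul.
Proof. by move=> f; apply: lie_aut_eq => x /=; apply: autK. Qed.

HB.instance Definition _ := isGroup.Build lie_aut
  aut_mulA aut_mul1 aut_mulr1 aut_mulV aut_mulrV.

Definition normal_auts : set lie_aut :=
  [set f : lie_aut | forall I : set L, is_lie_ideal I -> aut_fun f @` I = I].

End Automorphisms.

Arguments normal_auts {K} L.

(* Groups are represented as subgroups, in the sense of [is_subgroup], of a
   possibly infinite ambient group. *)
Section Groups.
Variable gT : groupType.
Implicit Types (G H A B : set gT) (x y : gT).
Local Open Scope group_scope.

Definition is_subgroup G : Prop :=
  G 1 /\ forall x y, G x -> G y -> G (x * y^-1).

Definition grp_abelian G : Prop := forall x y, G x -> G y -> x * y = y * x.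

Definition grp_commutator A B : set gT :=
  smallest is_subgroup [set [~ x, y] | x in A & y in B].

Definition grp_metabelian G : Prop := grp_abelian (grp_commutator G G).

(* The indexing is 1-based: grp_lcs G 1 = G and
   grp_lcs G k.+2 = [grp_lcs G k.+1, G]. *)
Definition grp_lcs G (k : nat) : set gT :=
  iter k.-1 (fun A => grp_commutator A G) G.

Definition grp_nilpotent_le G (c : nat) : Prop := grp_lcs G c.+1 = [set 1].

Definition grp_nilpotent_class G (c : nat) : Prop :=
  grp_nilpotent_le G c /\ forall d, (d < c)%N -> ~ grp_nilpotent_le G d.

Definition grp_normal H G : Prop :=
  [/\ is_subgroup H, H `<=` G & forall x y, H x -> G y -> H (x ^ y)].

Definition grp_lcoset x H : set gT := [set x * h | h in H].

Definition set_mulg A B : set gT := [set a * b | a in A & b in B].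

(* For H normal in G: the elements of G / H are the cosets of H, multiplied
   pointwise. *)
Definition grp_quotient_abelian G H : Prop :=
  forall x y, G x -> G y ->
    set_mulg (grp_lcoset x H) (grp_lcoset y H)
    = set_mulg (grp_lcoset y H) (grp_lcoset x H).

Definition grp_nil2_by_abelian G : Prop :=
  exists H : set gT,
    [/\ grp_normal H G, grp_nilpotent_le H 2 & grp_quotient_abelian G H].

End Groups.

Lemma normal_auts_subgroup (K : fieldType) (L : lieAlgType K) :
  is_subgroup (normal_auts L).
Proof.
split=> [I _|f g nf ng I iI]; first by rewrite image_id.
have ngV : aut_fun (g^-1)%g @` I = I.
  rewrite -{1}(ng I iI); apply/seteqP; split=> [_ [_ [x Ix <-] <-]|x Ix].
    by rewrite [aut_fun _ _]aut_invK.
  by exists (g x); [exists x|rewrite [aut_fun _ _]aut_invK].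
by rewrite -[RHS](nf I iI) -{2}ngV image_comp.
Qed.

(* Main.v *)
Require Import Defs.
From HB Require Import structures.
From mathcomp Require Import all_boot all_order all_algebra ring.
From mathcomp Require Import boolp classical_sets.

(** Write L for the algebra, L' for its derived algebra and N for the group of
    normal automorphisms. Every subspace containing L' is an ideal, so a normal
    automorphism f acts on L/L' as a scalar a ([normal_aut_scalar]). In
    particular commutators of N act trivially on L/L'. The proof determines a,
    and then how f acts on L'.

    The scalar. In a graded quotient of L let p and q be linearly independent
    central elements of degrees i and j. The lines through p, q and p + q are
    ideals. Hence f multiplies p by a^i, q by a^j and p + q by a scalar, which
    forces a^i = a^j. If L has three generators and class at least 2, the pair
    (y2, [y0, y1]) survives in the sum of a line and a Heisenberg algebra, and
    a = a^2. If L has two generators and class at least 4, the pair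
    ([y0,y1,y0], [y0,y1,y1,y1]) does, and a^3 = a^4. As a is nonzero, a = 1 in
    both cases ([normal_aut_IA]). Neither pair exists for two generators and
    class 2 or 3, which is why these cases are stated apart.

    The action on L'. When L'' = 0, the adjoint maps of L commute on L', which
    thereby becomes a module over a commutative ring of operators. An
    automorphism trivial on L/L' is linear over this ring, and normality puts
    the image of u in the cyclic submodule generated by u. Two normal
    automorphisms trivial on L/L' therefore commute on L' ([normal_IA_comm]). In
    class 2 the elements of L' are central, normal automorphisms act on each of
    them by a scalar, and they commute on L' whatever a is
    ([class2_normal_comm]). So commutators of N are trivial on both L/L' and L'.
    Automorphisms x |-> x + d(x) of this kind commute, since d maps L to L' and
    kills L' ([trivial_auts_comm]), and N is metabelian
    ([normal_auts_metabelian]).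

    Small class. If a = 1 and L has class 2, then N is itself trivial on L/L' and
    L', hence abelian. In class 3 the automorphisms trivial on L/L' form a
    nilpotent group of class at most 2, because their commutators are trivial
    modulo the third term L^3 and such automorphisms are central
    ([class3_IA_nilpotent]). When a = 1 this group is N; for two generators it
    is a normal subgroup of N with abelian quotient. The class is exactly 2
    because exp(ad y0) and exp(ad y1) are normal and do not commute
    ([free_metab_nil3_noncommuting]). This is the only use of the
    characteristic: the exponential in class 3 requires a half. *)
Set Implicit Arguments.
Unset Strict Implicit.
Unset Printing Implicit Defensive.

Import GRing.Theory.

(** * Commutators and nilpotent groups of class two *)

Section Commutators.
Variable gT : groupType.
Implicit Types (A B H : set gT) (x y : gT).
Local Open Scope classical_set_scope.
Local Open Scope group_scope.

Lemma grp_commutator_sub A B H : is_subgroup H ->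
  (forall x y, A x -> B y -> H [~ x, y]) -> grp_commutator A B `<=` H.
Proof.
by move=> sH AB; apply: smallest_sub => // _ [x Ax [y By <-]]; apply: AB.
Qed.

Lemma mem_grp_commutator A B x y : A x -> B y -> grp_commutator A B [~ x, y].
Proof. by move=> Ax By; apply: sub_gen_smallest; exists x => //; exists y. Qed.

Lemma grp_commutator1 A B : (forall x y, A x -> B y -> x * y = y * x) ->
  grp_commutator A B `<=` [set 1].
Proof.
move=> cAB; apply: grp_commutator_sub => [|x y Ax By] /=.
  by split=> // x y -> ->; rewrite invg1 mulg1.
by apply/eqP/commgP; apply: cAB.
Qed.

Lemma grp_nilpotent_le2 H A :
  is_subgroup A -> (forall x y, H x -> H y -> A [~ x, y]) ->
  (forall x y, A x -> H y -> x * y = y * x) -> grp_nilpotent_le H 2.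
Proof.
move=> sA HHA cAH; apply/seteqP; split=> [|_ ->]; last by move=> S [[S1 _] _].
apply: grp_commutator1 => x y xHH; apply: cAH.
exact: (grp_commutator_sub sA HHA) xHH.
Qed.

Lemma grp_nilpotent_class2 H x y :
  grp_nilpotent_le H 2 -> H x -> H y -> x * y <> y * x ->
  grp_nilpotent_class H 2.
Proof.
move=> nilH Hx Hy nxy; split=> // -[|[|//]] _ H1; apply: nxy.
  have H_1 z : H z -> z = 1 by rewrite -[H]/(grp_lcs H 1) H1.
  by rewrite (H_1 x) // (H_1 y).
apply/commgP/eqP; have := mem_grp_commutator Hx Hy.
by rewrite -[grp_commutator H H]/(grp_lcs H 2) H1.
Qed.

(** Cosets are multiplied as sets here. The inclusion follows from
    xayb = yx[x,y](a^y)b, and the other one by symmetry. *)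
Lemma grp_quotient_abelian_commg H A : grp_normal A H ->
  (forall x y, H x -> H y -> A [~ x, y]) -> grp_quotient_abelian H A.
Proof.
move=> [[A1 AV] AH nA] HHA.
have Ainv x : A x -> A x^-1 by move=> Ax; have := AV _ _ A1 Ax; rewrite mul1g.
have AM x y : A x -> A y -> A (x * y).
  by move=> Ax /Ainv Ay; have := AV _ _ Ax Ay; rewrite invgK.
have half x y : H x -> H y ->
  set_mulg (grp_lcoset x A) (grp_lcoset y A)
    `<=` set_mulg (grp_lcoset y A) (grp_lcoset x A).
  move=> Hx Hy _ [_ [a Aa <-] [_ [b Ab <-] <-]].
  exists y; first by exists 1; rewrite ?mulg1.
  have Ac : A ([~ x, y] * a ^ y * b).
    by apply: (AM) => //; apply: AM; [apply: HHA|apply: nA].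
  exists (x * ([~ x, y] * a ^ y * b)); first by eexists; [exact: Ac|].
  by rewrite !mulgA !mulgK mulgV mul1g.
by move=> x y Hx Hy; apply/seteqP; split; apply: half.
Qed.

End Commutators.

(** * Lie algebra morphisms and the lower central series *)

Section Morphisms.
Variables (K : fieldType) (L M : lieAlgType K) (f : L -> M).
Hypothesis fM : lie_morphism f.
Local Open Scope classical_set_scope.
Local Open Scope ring_scope.

Lemma lie_morph0 : f 0 = 0.
Proof. by have := fM.1 (-1) 0 0; rewrite !scaleN1r !addNr. Qed.

Lemma lie_morphD x y : f (x + y) = f x + f y.
Proof. by have := fM.1 1 x y; rewrite !scale1r. Qed.

Lemma lie_morphZ a x : f (a *: x) = a *: f x.
Proof. by have := fM.1 a x 0; rewrite !addr0 lie_morph0 addr0. Qed.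

Lemma lie_morphN x : f (- x) = - f x.
Proof. by rewrite -scaleN1r lie_morphZ scaleN1r. Qed.

Lemma lie_morphB x y : f (x - y) = f x - f y.
Proof. by rewrite lie_morphD lie_morphN. Qed.

Lemma preimage_subspace (A : set M) : is_subspace A -> is_subspace (f @^-1` A).
Proof.
move=> sA; split=> [|a x y Ax Ay] /=; first by rewrite lie_morph0; apply: sA.1.
by rewrite fM.1; apply: sA.2.
Qed.

Lemma image_subspace (A : set L) : is_subspace A -> is_subspace (f @` A).
Proof.
move=> sA; split; first by exists 0; [apply: sA.1|apply: lie_morph0].
by move=> a _ _ [x Ax <-] [y Ay <-]; exists (a *: x + y); [apply: sA.2|apply: fM.1].
Qed.

Lemma preimage_ideal (A : set M) : is_lie_ideal A -> is_lie_ideal (f @^-1` A).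
Proof.
move=> [sA iA]; split=> [|x y Ax /=]; first exact: preimage_subspace.
by rewrite fM.2; apply: iA.
Qed.

Lemma lie_prod_preimage (A B : set L) (A' B' : set M) :
  A `<=` f @^-1` A' -> B `<=` f @^-1` B' ->
  lie_prod A B `<=` f @^-1` lie_prod A' B'.
Proof.
move=> AA BB; apply: smallest_sub.
  by apply: preimage_subspace; apply: lie_prod_subspace.
move=> _ [x Ax [y By <-]] /=; rewrite fM.2; apply: sub_gen_smallest.
by exists (f x); [apply: AA|exists (f y) => //; apply: BB].
Qed.

Lemma lie_prod_image (A B : set L) (A' B' : set M) :
  A' `<=` f @` A -> B' `<=` f @` B -> lie_prod A' B' `<=` f @` lie_prod A B.
Proof.
move=> AA BB; apply: smallest_sub.
  by apply: image_subspace; apply: lie_prod_subspace.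
move=> _ [_ /AA[x Ax <-] [_ /BB[y By <-] <-]]; exists [lie x, y]; last exact: fM.2.
by apply: sub_gen_smallest; exists x => //; exists y.
Qed.

Lemma lie_lcs_preimage k : lie_lcs L k `<=` f @^-1` lie_lcs M k.
Proof.
by rewrite /lie_lcs; elim: k.-1 => [|j IHj] //=; apply: lie_prod_preimage.
Qed.

Lemma lie_derived2_preimage : lie_derived2 L `<=` f @^-1` lie_derived2 M.
Proof. by do 2!apply: lie_prod_preimage => //. Qed.

(** Surjectivity enters at every step of the series, to lift the second
    factor of the bracket. It serves to transfer identities of the free Lie
    algebra to its quotients. *)
Lemma lie_lcs_image k : range f = setT -> lie_lcs M k `<=` f @` lie_lcs L k.
Proof.
move=> fT; rewrite /lie_lcs; elim: k.-1 => [|j IHj] /=; first by rewrite fT.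
by apply: lie_prod_image => //; rewrite fT.
Qed.

End Morphisms.

Section LieSeries.
Variables (K : fieldType) (L : lieAlgType K).
Implicit Types (A B S : set L) (x y z u : L).
Local Open Scope classical_set_scope.
Local Open Scope ring_scope.

Lemma lie_prod_sub A B S : is_subspace S ->
  (forall x y, A x -> B y -> S [lie x, y]) -> lie_prod A B `<=` S.
Proof.
by move=> sS AB; apply: smallest_sub => // _ [x Ax [y By <-]]; apply: AB.
Qed.

Lemma mem_lie_prod A B x y : A x -> B y -> lie_prod A B [lie x, y].
Proof. by move=> Ax By; apply: sub_gen_smallest; exists x => //; exists y. Qed.

Lemma mem_lie_derived x y : lie_derived L [lie x, y].
Proof. exact: mem_lie_prod. Qed.

Lemma mem_lie_lcs k x y : lie_lcs L k.+1 x -> lie_lcs L k.+2 [lie x, y].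
Proof. by move=> Lx; apply: (mem_lie_prod (B := setT) Lx). Qed.

Lemma is_subspace1 : is_subspace [set 0 : L].
Proof. by split=> // a x y -> ->; rewrite scaler0 addr0. Qed.

Lemma lie_derived_ideal : is_lie_ideal (lie_derived L).
Proof. exact: (lie_lcs_ideal L 2). Qed.

Lemma lie_lcs_le j k : (j <= k)%N -> lie_lcs L k.+1 `<=` lie_lcs L j.+1.
Proof.
elim: k => [|k IHk]; first by case: j.
rewrite leq_eqVlt => /predU1P[-> //|/IHk]; apply: subset_trans.
have [sL iL] := lie_lcs_ideal L k.+1.
by apply: lie_prod_sub => // x y Lx _; apply: iL.
Qed.

Lemma lie_derivation x y u :
  [lie [lie x, y], u] = [lie [lie x, u], y] + [lie x, [lie y, u]].
Proof.
have := lie_jacobi x y u; rewrite (lieC u [lie x, y]) => /eqP.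
by rewrite subr_eq0 => /eqP <-; rewrite (lieC u x) lieNr (lieC y [lie x, u]) opprK addrC.
Qed.

End LieSeries.

(** * Normal automorphisms of an arbitrary Lie algebra *)

Section NormalAutomorphisms.
Variables (K : fieldType) (L : lieAlgType K).
Implicit Types (A J : set L) (f g : lie_aut L) (x y u : L).
Local Open Scope classical_set_scope.
Local Open Scope ring_scope.

Local Notation D := (lie_derived L).
Local Notation N := (@normal_auts K L).

Definition line u : set L := [set a *: u | a in setT].

Lemma line_subspace u : is_subspace (line u).
Proof.
split; first by exists 0; rewrite ?scale0r.
move=> a _ _ [b _ <-] [c _ <-]; exists (a * b + c) => //.
by rewrite scalerDl scalerA.
Qed.

Lemma line_ideal u : (forall x, [lie u, x] = 0) -> is_lie_ideal (line u).
Proof.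
move=> cu; split=> [|_ y [a _ <-]]; first exact: line_subspace.
by rewrite lieZl cu scaler0; apply: (line_subspace u).1.
Qed.

Lemma lie_aut_morph f : lie_morphism f. Proof. exact: (lie_autP f).1. Qed.

Lemma lie_aut_inj f : injective f. Proof. exact: bij_inj (lie_autP f).2. Qed.

Lemma lie_aut_derived f u : D u -> D (f u).
Proof. exact: (lie_lcs_preimage (lie_aut_morph f) (k := 2)). Qed.

Lemma normal_aut_ideal f J x : N f -> is_lie_ideal J -> J x -> J (f x).
Proof. by move=> Nf iJ Jx; rewrite -(Nf J iJ); exists x. Qed.

Lemma normal_aut_ideal_inv f J x : N f -> is_lie_ideal J -> J (f x) -> J x.
Proof. by move=> Nf iJ; rewrite -{1}(Nf J iJ) => -[y Jy /lie_aut_inj <-]. Qed.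

Lemma normal_autV f : N f -> N (f^-1)%g.
Proof.
have [N1 NV] := normal_auts_subgroup L.
by move=> Nf; have := NV _ _ N1 Nf; rewrite mul1g.
Qed.

Lemma normal_autM f g : N f -> N g -> N (f * g)%g.
Proof.
have [N1 NV] := normal_auts_subgroup L.
by move=> Nf Ng; have := NV _ _ Nf (normal_autV Ng); rewrite invgK.
Qed.

(** These congruence subgroups carry the whole argument: A and J are L, L',
    L^3 or 0, the whole of L with J = L' giving the automorphisms that are
    trivial on the abelianization. *)
Definition normal_fix A J : set (lie_aut L) :=
  [set f | N f /\ forall x, A x -> J (f x - x)].

Lemma normal_fix_subgroup A J :
  is_lie_ideal A -> is_subspace J -> is_subgroup (normal_fix A J).
Proof.
move=> iA sJ; split.
  by split=> [|x _]; [apply: (normal_auts_subgroup L).1|rewrite subrr; apply: sJ.1].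
move=> f g [Nf fJ] [Ng gJ]; split; first exact: (normal_auts_subgroup L).2.
move=> x Ax; set y := (g^-1)%g x.
have xE : x = g y by rewrite /y [RHS]autK.
have Ay : A y by apply: normal_aut_ideal Ax => //; apply: normal_autV.
rewrite [(f * g^-1)%g x]/(f y) xE -(subrKA y) -[y - g y]opprB.
by apply: (subspaceD sJ); [apply: fJ|apply: (subspaceN sJ); apply: gJ].
Qed.

(** Since fg = gf[f,g], the difference fg(x) - gf(x) is the image under gf of
    [f,g](x) - x, and gf, being normal, reflects membership in J. *)
Lemma normal_fix_commg A J f g : is_lie_ideal J -> N f -> N g ->
  (forall x, A x -> J (f (g x) - g (f x))) -> normal_fix A J [~ f, g]%g.
Proof.
move=> iJ Nf Ng cfg; split.
  rewrite /commg /conjg; apply: normal_autM; first exact: normal_autV.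
  by apply: normal_autM; [apply: normal_autV|apply: normal_autM].
move=> x Ax; apply: (normal_aut_ideal_inv (f := (g * f)%g)) => //.
  exact: normal_autM.
rewrite (lie_morphB (lie_aut_morph (g * f)%g)).
have -> : (g * f)%g ([~ f, g]%g x) = (f * g)%g x by rewrite [in RHS]commgC.
exact: cfg.
Qed.

Lemma normal_fix_normal A J : is_lie_ideal A -> is_lie_ideal J ->
  grp_normal (normal_fix A J) N.
Proof.
move=> iA iJ; split=> [|f []//|f g [Nf fJ] Ng].
  by apply: normal_fix_subgroup => //; apply: iJ.1.
split.
  by apply: normal_autM; [apply: normal_autV|apply: normal_autM].
move=> x Ax; set z := (f ^ g)%g x - x.
apply: (normal_aut_ideal_inv Ng iJ); rewrite /z (lie_morphB (lie_aut_morph g)).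
have -> : g ((f ^ g)%g x) = f (g x).
  by rewrite -[LHS]/((g * f ^ g)%g x) -conjgC.
by apply: fJ; apply: normal_aut_ideal Ax.
Qed.

(** Brackets lie in D, so a line plus D is an ideal. *)
Lemma normal_aut_eigen f x : N f -> exists a, D (f x - a *: x).
Proof.
move=> Nf.
have iJ : is_lie_ideal (set_add (line x) D).
  split; last first.
    move=> u y _; exists 0; first exact: (line_subspace x).1.
    by exists [lie u, y]; [apply: mem_lie_derived|rewrite add0r].
  have [lx0 lxD] := line_subspace x; have [D0 DD] := (lie_derived_ideal L).1.
  split; first by exists 0 => //; exists 0; rewrite ?addr0.
  move=> a _ _ [u xu [v Dv <-]] [u' xu' [v' Dv' <-]].
  exists (a *: u + u'); first exact: lxD.
  by exists (a *: v + v'); [exact: DD|rewrite scalerDr addrACA].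
have : set_add (line x) D (f x).
  apply: (normal_aut_ideal Nf iJ); exists x; first by exists 1; rewrite ?scale1r.
  by exists 0; [apply: (lie_derived_ideal L).1.1|rewrite addr0].
by case=> _ [a _ <-] [d Dd <-]; exists a; rewrite addrC addKr.
Qed.

(** At x both automorphisms act modulo D as scalars, and scalars commute. The
    scalars may still depend on x here. *)
Lemma normal_auts_comm_mod f g x : N f -> N g -> D (f (g x) - g (f x)).
Proof.
move=> Nf Ng; have [a fa] := normal_aut_eigen x Nf; have [b gb] := normal_aut_eigen x Ng.
have sD := (lie_derived_ideal L).1.
have fE : f (g x) - (b * a) *: x = f (g x - b *: x) + b *: (f x - a *: x).
  rewrite (lie_morphB (lie_aut_morph f)) (lie_morphZ (lie_aut_morph f)).
  by rewrite scalerBr scalerA subrKA.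
have gE : g (f x) - (b * a) *: x = g (f x - a *: x) + a *: (g x - b *: x).
  rewrite (lie_morphB (lie_aut_morph g)) (lie_morphZ (lie_aut_morph g)).
  by rewrite scalerBr scalerA subrKA [a * b]mulrC.
rewrite -(subrKA ((b * a) *: x)) -[_ - g _]opprB fE gE.
by apply: (subspaceD sD); last apply: (subspaceN sD);
  apply: (subspaceD sD); do ?apply: lie_aut_derived => //; apply: (subspaceZ _ sD).
Qed.

Lemma fixed_subspace f : is_subspace [set v | f v = v].
Proof.
have fM := lie_aut_morph f; split=> [|a v w /= hv hw]; first exact: lie_morph0.
by rewrite fM.1 hv hw.
Qed.

(** Altering x and y by central elements does not change their bracket. The
    set J is D in class two and the third term of the series in class three. *)
Lemma fix_derived_of_central f J u : (forall v x, J v -> [lie v, x] = 0) ->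
  (forall x, J (f x - x)) -> D u -> f u = u.
Proof.
move=> cJ fJ; suff h : D `<=` [set v | f v = v] by apply: h.
apply: lie_prod_sub => [|x y _ _ /=]; first exact: fixed_subspace.
rewrite (lie_aut_morph f).2 -[f x](subrK x) -[f y](subrK y) lieDl cJ // add0r.
by rewrite lieDr lieC cJ // oppr0 add0r.
Qed.

(** Both composites map x to x + (f x - x) + (g x - x). *)
Lemma trivial_auts_comm f g :
  (forall x, D (f x - x)) -> (forall u, D u -> f u = u) ->
  (forall x, D (g x - x)) -> (forall u, D u -> g u = u) ->
  (f * g = g * f)%g.
Proof.
move=> fD f1 gD g1; apply: lie_aut_eq => x.
change (f (g x) = g (f x)).
have {1}-> : g x = (g x - x) + x by rewrite subrK.
rewrite (lie_morphD (lie_aut_morph f)) (f1 _ (gD x)).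
have -> : g (f x) = g (f x - x) + g x by rewrite -(lie_morphD (lie_aut_morph g)) subrK.
by rewrite (g1 _ (fD x)) addrAC [RHS]addrAC [g x + _]addrC.
Qed.

(** Commutators are trivial on L/D by [normal_auts_comm_mod] and on D by
    hypothesis, so [trivial_auts_comm] applies to any two of them. *)
Lemma normal_auts_metabelian :
  (forall f g u, N f -> N g -> D u -> f (g u) = g (f u)) ->
  grp_metabelian N.
Proof.
move=> cD.
have sub1 : grp_commutator N N `<=` normal_fix setT D.
  apply: grp_commutator_sub => [|f g Nf Ng].
    by apply: normal_fix_subgroup; [apply: is_lie_idealT|apply: (lie_derived_ideal L).1].
  apply: normal_fix_commg => //; first exact: lie_derived_ideal.
  by move=> x _; apply: normal_auts_comm_mod.
have i0 : is_lie_ideal [set 0 : L].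
  by split; [apply: is_subspace1|move=> x y ->; rewrite /= lie0l].
have sub2 : grp_commutator N N `<=` normal_fix D [set 0].
  apply: grp_commutator_sub => [|f g Nf Ng].
    by apply: normal_fix_subgroup; [apply: lie_derived_ideal|apply: is_subspace1].
  by apply: normal_fix_commg => // u Du /=; rewrite cD ?subrr.
have fixD f u : grp_commutator N N f -> D u -> f u = u.
  by move=> /sub2[_ fu] /fu /eqP; rewrite subr_eq0 => /eqP.
move=> f g cf cg; apply: trivial_auts_comm.
- by move=> x; apply: (sub1 _ cf).2.
- by move=> u; apply: fixD.
- by move=> x; apply: (sub1 _ cg).2.
- by move=> u; apply: fixD.
Qed.

(** The values at u of these operators, the polynomials in the adjoint maps,
    form the ideal generated by u. *)
Inductive ad_poly : (L -> L) -> Prop :=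
  | ad_poly0 : ad_poly (fun=> 0)
  | ad_poly1 : ad_poly id
  | ad_polyZD a F G : ad_poly F -> ad_poly G -> ad_poly (fun u => a *: F u + G u)
  | ad_polyM F x : ad_poly F -> ad_poly (fun u => [lie F u, x]).

Lemma ad_poly_derived F u : ad_poly F -> D u -> D (F u).
Proof.
have [[D0 sD] iD] := lie_derived_ideal L.
by move=> pF Du; elim: pF => //= *; [apply: sD|apply: iD].
Qed.

Lemma normal_aut_ad_poly f u : N f -> exists2 F, ad_poly F & f u = F u.
Proof.
move=> Nf; pose I := [set v | exists2 F, ad_poly F & v = F u].
suff iI : is_lie_ideal I.
  by apply: (normal_aut_ideal Nf iI); exists id => //; apply: ad_poly1.
split; first split.
- by exists (fun=> 0) => //; apply: ad_poly0.
- move=> a _ _ [F pF ->] [G pG ->].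
  by exists (fun v => a *: F v + G v) => //; exact: (ad_polyZD a pF pG).
- by move=> _ y [F pF ->]; exists (fun v => [lie F v, y]) => //; exact: (ad_polyM y pF).
Qed.

(** ** Metabelian Lie algebras *)

Section Metabelian.
Hypothesis metL : forall u v, D u -> D v -> [lie u, v] = 0.

(** The two sides differ by the bracket of u with [x, y], which vanishes as
    both lie in the derived algebra. *)
Lemma ad_comm u x y : D u -> [lie [lie u, x], y] = [lie [lie u, y], x].
Proof.
by move=> Du; rewrite lie_derivation (metL Du (mem_lie_derived x y)) addr0.
Qed.

Lemma ad_poly_ad F u x : ad_poly F -> D u -> F [lie u, x] = [lie F u, x].
Proof.
move=> pF Du; elim: pF => //=; first by rewrite lie0l.
  by move=> a F' G' _ -> _ ->; rewrite lieDl lieZl.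
by move=> F' y pF' ->; rewrite ad_comm //; apply: ad_poly_derived.
Qed.

Lemma ad_poly_linear F : ad_poly F -> linear F.
Proof.
elim=> //=; first by move=> a x y; rewrite scaler0 addr0.
  move=> a F' G' _ lF _ lG b x y; rewrite lF lG !scalerDr addrACA.
  by rewrite !scalerA [a * b]mulrC.
by move=> F' x _ lF a u v; rewrite lF lieDl lieZl.
Qed.

(** On D the operators form a commutative ring, a quotient of a polynomial
    ring on the abelianization. *)
Lemma ad_poly_comm F G u : ad_poly F -> ad_poly G -> D u -> F (G u) = G (F u).
Proof.
move=> pF pG Du; elim: pG => //=.
- by have := ad_poly_linear pF (-1) 0 0; rewrite !scaleN1r !addNr.
- by move=> a G1 G2 _ h1 _ h2; rewrite ad_poly_linear // h1 h2.
- by move=> G1 x pG1 h1; rewrite ad_poly_ad ?h1 //; apply: ad_poly_derived.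
Qed.

(** Replacing x by f x in an adjoint map acting on D adds the adjoint map of
    an element of D, which is zero there. *)
Lemma IA_ad_poly f F u :
  (forall x, D (f x - x)) -> ad_poly F -> D u -> f (F u) = F (f u).
Proof.
move=> fD pF Du; have fM := lie_aut_morph f; elim: pF => //=.
- exact: lie_morph0.
- by move=> a F' G' _ hF _ hG; rewrite fM.1 hF hG.
- move=> F' x pF' hF; rewrite fM.2 hF -[f x](subrK x) lieDr metL ?add0r //.
  by apply: ad_poly_derived => //; apply: lie_aut_derived.
Qed.

(** If f u = F u and g u = G u, then f(g u) = G(F u) and g(f u) = F(G u) by
    linearity over the operators. The operators F and G depend on u, but it is
    enough to compare the two sides at one u. *)
Lemma normal_IA_comm f g u : N f -> N g ->
  (forall x, D (f x - x)) -> (forall x, D (g x - x)) ->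
  D u -> f (g u) = g (f u).
Proof.
move=> Nf Ng fD gD Du.
have [F pF fE] := normal_aut_ad_poly u Nf; have [G pG gE] := normal_aut_ad_poly u Ng.
by rewrite gE IA_ad_poly // fE (ad_poly_comm pG) // -gE -IA_ad_poly.
Qed.

End Metabelian.

(** ** Class two *)

Section ClassTwo.
Hypothesis cl2 : forall u x, D u -> [lie u, x] = 0.

(** Every u in D is central, so its line is an ideal and u is an eigenvector
    of both automorphisms. *)
Lemma class2_normal_comm f g u : N f -> N g -> D u -> f (g u) = g (f u).
Proof.
move=> Nf Ng Du; have iu := line_ideal (fun x => cl2 x Du).
have lu : line u u by exists 1; rewrite ?scale1r.
have [a _ fE] := normal_aut_ideal Nf iu lu; have [b _ gE] := normal_aut_ideal Ng iu lu.
rewrite -fE -gE (lie_morphZ (lie_aut_morph f)) (lie_morphZ (lie_aut_morph g)).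
by rewrite -fE -gE !scalerA mulrC.
Qed.

Lemma class2_IA_abelian : (forall f x, N f -> D (f x - x)) -> grp_abelian N.
Proof.
move=> NIA f g Nf Ng.
have fixD h u : N h -> D u -> h u = u.
  by move=> Nh; apply: (fix_derived_of_central cl2) => x; apply: NIA.
by apply: trivial_auts_comm => *; [apply: NIA|apply: fixD|apply: NIA|apply: fixD].
Qed.

End ClassTwo.

(** ** Class three *)

Section ClassThree.
Local Notation L3 := (lie_lcs L 3).
Hypothesis metL : forall u v, D u -> D v -> [lie u, v] = 0.
Hypothesis cl3 : forall u x, L3 u -> [lie u, x] = 0.

Lemma class3_IA_lcs2 f u : (forall x, D (f x - x)) -> D u -> L3 (f u - u).
Proof.
have fM := lie_aut_morph f; move=> fD.
have [sL iL] := lie_lcs_ideal L 3.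
suff h : D `<=` [set v | L3 (f v - v)] by apply: h.
apply: lie_prod_sub => /=; first split=> [|a v w /= hv hw].
- by rewrite /= (lie_morph0 fM) subrr; apply: sL.1.
- by rewrite fM.1 opprD addrACA -scalerBr; apply: sL.2.
- move=> x y _ _; rewrite fM.2 -[f x](subrK x) lieDl -addrA -lieNr -lieDr.
  apply: (subspaceD sL); first exact: (mem_lie_lcs (k := 1) _ (fD x)).
  by rewrite lieC; apply: (subspaceN sL); apply: (mem_lie_lcs (k := 1) _ (fD y)).
Qed.

Lemma class3_IA_fix_lcs3 f u : (forall x, D (f x - x)) -> L3 u -> f u = u.
Proof.
have fM := lie_aut_morph f; move=> fD.
suff h : L3 `<=` [set v | f v = v] by apply: h.
apply: lie_prod_sub => [|v y Dv _ /=]; first exact: fixed_subspace.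
rewrite fM.2 -[f y](subrK y) lieDr metL //; last exact: lie_aut_derived.
by rewrite add0r -[f v](subrK v) lieDl cl3 ?add0r //; apply: class3_IA_lcs2.
Qed.

(** The intermediate subgroup consists of the automorphisms trivial modulo L3.
    These fix D, while the automorphisms trivial modulo D fix L3; hence for f in
    the former and g in the latter group both composites map x to
    x + (f x - x) + (g x - x). *)
Lemma class3_IA_nilpotent : grp_nilpotent_le (normal_fix setT D) 2.
Proof.
have [sL iL] := lie_lcs_ideal L 3.
have sD := (lie_derived_ideal L).1.
apply: (grp_nilpotent_le2 (A := normal_fix setT L3)).
- by apply: normal_fix_subgroup => //; apply: is_lie_idealT.
- move=> f g [Nf fD] [Ng gD]; apply: normal_fix_commg => //.
  move=> x _; have fM := lie_aut_morph f; have gM := lie_aut_morph g.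
  have -> : f (g x) - g (f x) =
      (f (g x - x) - (g x - x)) - (g (f x - x) - (f x - x)).
    by rewrite (lie_morphB fM) (lie_morphB gM) !opprB addrACA !subrKA.
  apply: (subspaceD sL); first exact: class3_IA_lcs2 (fun y => fD y I) (gD x I).
  apply: (subspaceN sL).
  exact: class3_IA_lcs2 (fun y => gD y I) (fD x I).
- move=> f g [_ fL] [_ gD]; apply: lie_aut_eq => x.
  change (f (g x) = g (f x)).
  have {1}-> : g x = (g x - x) + x by rewrite subrK.
  rewrite (lie_morphD (lie_aut_morph f)) (fix_derived_of_central cl3 (fun y => fL y I) (gD x I)).
  have -> : g (f x) = g (f x - x) + g x by rewrite -(lie_morphD (lie_aut_morph g)) subrK.
  rewrite (class3_IA_fix_lcs3 (fun y => gD y I) (fL x I)).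
  by rewrite addrAC [RHS]addrAC [g x + _]addrC.
Qed.

(** The exponential of the adjoint map of u, whose cube is zero in class
    three. *)
Definition lie_exp u x : L := x + [lie x, u] + 2%:R^-1 *: [lie [lie x, u], u].

Lemma lie_exp_ideal u J x : is_lie_ideal J -> J x -> J (lie_exp u x).
Proof.
move=> [sJ iJ] Jx; apply: (subspaceD sJ).
  by apply: (subspaceD sJ) => //; apply: iJ.
by apply: (subspaceZ _ sJ); apply: (iJ); apply: iJ.
Qed.

Lemma mem_lcs3 x y z : L3 [lie [lie x, y], z].
Proof. exact: (mem_lie_lcs (k := 1) z (mem_lie_derived x y)). Qed.

(** In the expansion of the bracket of the images of x and y, the quadratic
    terms of the exponentials are central and the product of the linear terms is
    a bracket of two elements of D, so only the derivation rule remains. *)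
Lemma lie_exp_morphism u : lie_morphism (lie_exp u).
Proof.
split=> [a x y|x y].
  rewrite /lie_exp !lieDl !lieZl !scalerDr [2%:R^-1 *: (a *: _)]scalerA.
  rewrite [2%:R^-1 * a]mulrC -scalerA [RHS]addrACA.
  by congr (_ + _); rewrite addrACA.
rewrite {2 3}/lie_exp; set b := _ *: [lie [lie x, u], u].
set d := _ *: [lie [lie y, u], u].
have b0 v : [lie b, v] = 0 by rewrite /b lieZl cl3 ?scaler0 //; apply: mem_lcs3.
have d0 v : [lie v, d] = 0.
  by rewrite /d lieC lieZl cl3 ?scaler0 ?oppr0 //; apply: mem_lcs3.
rewrite (lieDl _ b) b0 addr0 (lieDr _ _ d) d0 addr0 lieDl !lieDr.
rewrite (metL (mem_lie_derived x u) (mem_lie_derived y u)) addr0.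
rewrite /lie_exp (cl3 _ (mem_lcs3 x y u)) scaler0 addr0 lie_derivation.
by rewrite -addrA [[lie [lie x, u], y] + _]addrC.
Qed.

Lemma lie_expK u : 2%:R != 0 :> K -> cancel (lie_exp u) (lie_exp (- u)).
Proof.
move=> two0 x; set a := [lie x, u]; set b := 2%:R^-1 *: [lie a, u].
have b2 : [lie a, u] = b + b.
  by rewrite -mulr2n -scaler_nat scalerA mulfV ?scale1r.
have b0 : [lie b, u] = 0 by rewrite lieZl cl3 ?scaler0 //; apply: mem_lcs3.
have au : [lie [lie a, u], u] = 0 by rewrite cl3 //; apply: mem_lcs3.
rewrite {1}/lie_exp !(lieNr, lieNl) opprK {1 2 3}/lie_exp -/a -/b.
rewrite !(lieDl, b0, au, lie0l, addr0) -/a -/b b2 opprD addrA [x + a + b]addrAC.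
by rewrite addrK opprD addrA addrK subrK.
Qed.

Lemma lie_exp_aut u : 2%:R != 0 :> K -> is_lie_aut (lie_exp u).
Proof.
move=> two0; split; first exact: lie_exp_morphism.
exists (lie_exp (- u)); first exact: lie_expK.
by rewrite -{2}(opprK u); apply: lie_expK.
Qed.

Lemma lie_exp_normal u (two0 : 2%:R != 0 :> K) :
  N (LieAut (asboolT (lie_exp_aut u two0))).
Proof.
move=> J iJ; apply/seteqP; split=> [_ [x Jx <-]|x Jx]; first exact: lie_exp_ideal.
exists (lie_exp (- u) x); first exact: lie_exp_ideal.
by rewrite /= -{1}(opprK u) lie_expK.
Qed.

(** As exp(ad u) fixes u, commuting at u means that exp(ad u) fixes
    exp(ad v)(u), whose bracket with u is the displayed triple bracket. *)
Lemma lie_exp_comm u v :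
  lie_exp u (lie_exp v u) = lie_exp v (lie_exp u u) -> [lie [lie u, v], u] = 0.
Proof.
rewrite {4}/lie_exp lie_alt lie0l scaler0 !addr0 {2}/lie_exp => H.
have {H}: lie_exp u (lie_exp v u) - lie_exp v u = 0 by rewrite H subrr.
set w := lie_exp v u; rewrite /lie_exp.
have wu : [lie w, u] = [lie [lie u, v], u].
  by rewrite /w /lie_exp !lieDl lie_alt add0r lieZl (cl3 _ (mem_lcs3 u v v)) scaler0 addr0.
by rewrite wu (cl3 _ (mem_lcs3 u v u)) scaler0 addr0 addrC addKr.
Qed.

End ClassThree.
End NormalAutomorphisms.

(** * A seven-dimensional metabelian Lie algebra *)

Section Model.
Variable K : fieldType.
Local Open Scope classical_set_scope.
Local Open Scope ring_scope.

(** The coordinates refer to a basis e, x1, x2, z, u, v, w whose nonzero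
    brackets are z = [x1,x2], [z,x1] = s u, [z,x2] = s v and [v,x2] = t w. The
    scalars s and t, usually 0 or 1, tune the class: it is at most 2 for
    s = t = 0, at most 3 for t = 0, and at most 4 in general. *)
Definition test_lie (s t : K) : Type := 'rV[K]_7.
HB.instance Definition _ s t := GRing.Lmodule.on (test_lie s t).

Variables s t : K.
Local Notation T := (test_lie s t).

Definition coor (k : nat) (ltk : (k < 7)%N) (p : T) : K := p 0 (Ordinal ltk).
Notation "p ^[ k ]" := (@coor k isT p) (at level 2, format "p ^[ k ]").

Definition vec (c : seq K) : T := \row_i c`_i.

Lemma coor_vec k (ltk : (k < 7)%N) c : coor ltk (vec c) = c`_k.
Proof. by rewrite /coor mxE. Qed.

Lemma coorD k (ltk : (k < 7)%N) p q : coor ltk (p + q) = coor ltk p + coor ltk q.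
Proof. by rewrite /coor mxE. Qed.

Lemma coorZ k (ltk : (k < 7)%N) a p : coor ltk (a *: p) = a * coor ltk p.
Proof. by rewrite /coor mxE. Qed.

Lemma coor0 k (ltk : (k < 7)%N) : coor ltk 0 = 0.
Proof. by rewrite /coor mxE. Qed.

Lemma test_lie_eq p q :
  [/\ p^[0] = q^[0], p^[1] = q^[1], p^[2] = q^[2] & p^[3] = q^[3]] ->
  [/\ p^[4] = q^[4], p^[5] = q^[5] & p^[6] = q^[6]] -> p = q.
Proof.
rewrite /coor => -[E0 E1 E2 E3] [E4 E5 E6]; apply/rowP => -[i lti].
by case: i lti => [|[|[|[|[|[|[|//]]]]]]] lti; rewrite (bool_irrelevance lti isT).
Qed.

Definition test_bracket (p q : T) : T :=
  vec [:: 0; 0; 0; p^[1] * q^[2] - q^[1] * p^[2];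
          s * (p^[3] * q^[1] - q^[3] * p^[1]); s * (p^[3] * q^[2] - q^[3] * p^[2]);
          t * (p^[5] * q^[2] - q^[5] * p^[2])].

Let coorE := (coorD, coorZ, coor0, coor_vec).

Lemma test_bracket_linearl q : linear (test_bracket^~ q).
Proof. by move=> a p r; apply: test_lie_eq; split; rewrite /test_bracket !coorE /=; ring. Qed.

Lemma test_bracket_linearr p : linear (test_bracket p).
Proof. by move=> a q r; apply: test_lie_eq; split; rewrite /test_bracket !coorE /=; ring. Qed.

Lemma test_bracket_alt p : test_bracket p p = 0.
Proof. by apply: test_lie_eq; split; rewrite /test_bracket !coorE /=; ring. Qed.

Lemma test_bracket_jacobi p q r :
  test_bracket p (test_bracket q r) + test_bracket q (test_bracket r p)
    + test_bracket r (test_bracket p q) = 0.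
Proof. by apply: test_lie_eq; split; rewrite /test_bracket !coorE /=; ring. Qed.

HB.instance Definition _ := Lmodule_isLieAlgebra.Build K T
  test_bracket_linearl test_bracket_linearr test_bracket_alt test_bracket_jacobi.

Lemma test_bracketE p q : [lie p, q] = test_bracket p q.
Proof. by []. Qed.

Lemma test_derived_sub :
  lie_derived T `<=` [set p | [/\ p^[0] = 0, p^[1] = 0 & p^[2] = 0]].
Proof.
apply: lie_prod_sub => [|p q _ _]; last by rewrite /= test_bracketE !coor_vec.
split=> [|a p q [p0 p1 p2] [q0 q1 q2]] /=; rewrite !coorE //.
by rewrite p0 p1 p2 q0 q1 q2 mulr0 addr0.
Qed.

Lemma test_metabelian u v : lie_derived T u -> lie_derived T v ->
  [lie u, v] = 0.
Proof.
move=> /test_derived_sub[u0 u1 u2] /test_derived_sub[v0 v1 v2].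
by apply: test_lie_eq; split; rewrite test_bracketE !coorE /= ?u1 ?u2 ?v1 ?v2; ring.
Qed.

Lemma test_lcs3_sub : lie_lcs T 3
  `<=` [set p | [/\ p^[0] = 0, p^[1] = 0, p^[2] = 0 & p^[3] = 0]].
Proof.
apply: lie_prod_sub => [|p q /test_derived_sub[p0 p1 p2] _] /=.
  split=> [|a p q [p0 p1 p2 p3] [q0 q1 q2 q3]] /=; rewrite !coorE //.
  by rewrite p0 p1 p2 p3 q0 q1 q2 q3 mulr0 addr0.
by rewrite test_bracketE !coorE /= p1 p2; split=> //; ring.
Qed.

Lemma test_lcs4_sub : lie_lcs T 4
  `<=` [set p | [/\ p^[1] = 0, p^[2] = 0, p^[3] = 0 & p^[5] = 0]].
Proof.
apply: lie_prod_sub => [|p q /test_lcs3_sub[p0 p1 p2 p3] _] /=.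
  split=> [|a p q [p1 p2 p3 p5] [q1 q2 q3 q5]] /=; rewrite !coorE //.
  by rewrite p1 p2 p3 p5 q1 q2 q3 q5 mulr0 addr0.
by rewrite test_bracketE !coorE /= p1 p2 p3; split=> //; ring.
Qed.

Lemma test_nilpotent :
  [/\ lie_lcs T 5 `<=` [set 0],
      t = 0 -> lie_lcs T 4 `<=` [set 0]
    & s = 0 -> t = 0 -> lie_lcs T 3 `<=` [set 0]].
Proof.
split=> [|t0|s0 t0]; (apply: lie_prod_sub => [|p q]; first exact: is_subspace1).
- move=> /test_lcs4_sub[p1 p2 p3 p5] _.
  by apply: test_lie_eq; split; rewrite test_bracketE !coorE /= ?p1 ?p2 ?p3 ?p5; ring.
- move=> /test_lcs3_sub[p0 p1 p2 p3] _.
  by apply: test_lie_eq; split; rewrite test_bracketE !coorE /= ?p1 ?p2 ?p3 ?t0; ring.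
- move=> /test_derived_sub[p0 p1 p2] _.
  by apply: test_lie_eq; split; rewrite test_bracketE !coorE /= ?p1 ?p2 ?s0 ?t0; ring.
Qed.

End Model.

Arguments vec {K s t} c.

Notation "p ^[ k ]" := (@coor _ _ _ k isT p) (at level 2, format "p ^[ k ]").

(** * Free metabelian nilpotent Lie algebras *)

Section FreeMetabelianNilpotent.
Variables (K : fieldType) (m c : nat).
Local Open Scope classical_set_scope.
Local Open Scope ring_scope.

Local Notation L := (free_metab_nil K m c).
Local Notation I := (metab_nil_ideal (free_lie K m) c).

Let range_proj : range (quot_proj I) = setT.
Proof.
by apply/seteqP; split=> // u _; have [x ->] := quot_proj_surj u; exists x.
Qed.

Lemma free_metab_nil_metabelian (u v : L) :
  lie_derived L u -> lie_derived L v -> [lie u, v] = 0.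
Proof.
move=> Du Dv; have pM := quot_proj_morphism I.
have [x Dx <-] := lie_lcs_image (k := 2) pM range_proj Du.
have [y Dy <-] := lie_lcs_image (k := 2) pM range_proj Dv.
rewrite -pM.2 -(lie_morph0 pM); apply/quot_projP; rewrite subr0.
exists [lie x, y]; first exact: mem_lie_prod.
by exists 0; rewrite ?addr0 //; apply: (lie_lcs_ideal (free_lie K m) c.+1).1.1.
Qed.

Lemma free_metab_nil_class : lie_lcs L c.+1 `<=` [set 0].
Proof.
move=> u Lu; have pM := quot_proj_morphism I.
have [x Lx <-] := lie_lcs_image pM range_proj Lu.
rewrite /= -(lie_morph0 pM); apply/quot_projP; rewrite subr0.
by exists 0; [apply: (lie_prod_subspace _ _).1|exists x; rewrite ?add0r].
Qed.

Definition free_metab_nil_gen (i : 'I_m) : L := quot_proj I (free_gen K i).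

(** The universal property, among metabelian Lie algebras of class at most
    c. *)
Lemma free_metab_nil_lift (M : lieAlgType K) (h : 'I_m -> M) :
  (forall u v : M, lie_derived M u -> lie_derived M v -> [lie u, v] = 0) ->
  lie_lcs M c.+1 `<=` [set 0] ->
  exists F : L -> M, lie_morphism F /\ forall i, F (free_metab_nil_gen i) = h i.
Proof.
move=> metM clM; have hM := free_lift_morphism h; have pM := quot_proj_morphism I.
have kerI x y : quot_proj I x = quot_proj I y -> free_lift h x = free_lift h y.
  move=> /quot_projP[u Du [v Lv uv]]; apply/eqP; rewrite -subr_eq0; apply/eqP.
  rewrite -(lie_morphB hM) -uv (lie_morphD hM).
  have -> : free_lift h u = 0.
    have M2 : lie_derived2 M `<=` [set 0].
      by apply: lie_prod_sub => [|a b Da Db /=]; [apply: is_subspace1|apply: metM].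
    exact: (M2 _ (lie_derived2_preimage hM Du)).
  by rewrite add0r (clM _ (lie_lcs_preimage hM Lv)).
have FE x : free_lift h (repr (quot_proj I x)) = free_lift h x.
  by apply: kerI; rewrite /quot_proj reprK.
exists (fun u => free_lift h (repr u)); split; last first.
  by move=> i; rewrite /free_metab_nil_gen FE free_lift_gen.
split=> [a u v|u v];
  have [x ->] := quot_proj_surj u; have [y ->] := quot_proj_surj v.
  by rewrite -pM.1 !FE hM.1.
by rewrite -pM.2 !FE hM.2.
Qed.

End FreeMetabelianNilpotent.

(** * The scalar of a normal automorphism on the abelianization *)

Section Scalars.
Variables (K : fieldType) (L : lieAlgType K).
Implicit Types (f : lie_aut L) (x y : L).
Local Open Scope classical_set_scope.
Local Open Scope ring_scope.
Local Notation D := (lie_derived L).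
Local Notation N := (@normal_auts K L).

(** A linear map for which every vector is an eigenvector is a scalar, applied
    to L/D. The element y witnesses that L/D is nonzero: its eigenvalue is
    nonzero because f reflects membership in D. *)
Lemma normal_aut_scalar f y : N f -> ~ D y ->
  exists2 a, a != 0 & forall x, D (f x - a *: x).
Proof.
move=> Nf nDy; have fM := lie_aut_morph f; have iD := lie_derived_ideal L.
have [sD _] := iD; have [a fy] := normal_aut_eigen y Nf; exists a.
  apply: contra_not_neq nDy => a0.
  by move: fy; rewrite a0 scale0r subr0; apply: normal_aut_ideal_inv.
move=> x; have [b fx] := normal_aut_eigen x Nf.
have [d fxy] := normal_aut_eigen (y + x) Nf.
(* The linear relation in L/D obtained by evaluating f at y + x twice. *)
have dep : D ((d - a) *: y + (d - b) *: x).
  have -> : (d - a) *: y + (d - b) *: x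
      = (f y - a *: y) + (f x - b *: x) - (f (y + x) - d *: (y + x)).
    rewrite (lie_morphD fM) opprB [RHS]addrC [f y - a *: y + _]addrACA subrKA.
    by rewrite scalerDr !scalerBl addrACA.
  by apply: (subspaceD sD); [apply: (subspaceD sD)|apply: (subspaceN sD)].
(* If d = b, the relation is (b - a) y = 0 in L/D, so b = a; otherwise x lies
   in the line of y modulo D and has the same eigenvalue. *)
have [db|db] := eqVneq d b.
  move: dep; rewrite db subrr scale0r addr0 => bay.
  have [<-//|ba] := eqVneq b a; case: nDy.
  have := subspaceZ (b - a)^-1 sD bay; rewrite scalerA mulVf ?scale1r //.
  by rewrite subr_eq0.
set W := (_ + _) in dep.
have fW : (d - b) *: (f x - a *: x) = f W - a *: W - (d - a) *: (f y - a *: y).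
  rewrite /W (lie_morphD fM) !(lie_morphZ fM) (scalerDr a) opprD addrACA.
  rewrite !scalerA ![a * _]mulrC -!scalerA -!scalerBr.
  by rewrite [RHS]addrC addKr.
rewrite -[f x - _]scale1r -(mulVf (x := d - b)) ?subr_eq0 // -scalerA fW.
apply: (subspaceZ _ sD); apply: (subspaceD sD).
  apply: (subspaceD sD); first exact: lie_aut_derived.
  by apply: (subspaceN sD); apply: (subspaceZ _ sD).
by apply: (subspaceN sD); apply: (subspaceZ _ sD).
Qed.

(** The preimage of the line through F x is an ideal of L even when F is not
    surjective. *)
Lemma normal_aut_central (M : lieAlgType K) (F : L -> M) f x :
  lie_morphism F -> N f -> (forall v, [lie F x, v] = 0) ->
  exists a, F (f x) = a *: F x.
Proof.
move=> FM Nf cx; have := preimage_ideal FM (line_ideal cx).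
move/(normal_aut_ideal Nf) => /(_ x) [|a _ <-]; last by exists a.
by exists 1; rewrite ?scale1r.
Qed.

End Scalars.

(** * The scalar is one *)

Section NormalAutomorphismsOfFree.
Variables (K : fieldType) (m c : nat).
Local Open Scope classical_set_scope.
Local Open Scope ring_scope.

Local Notation L := (free_metab_nil K m c).
Local Notation D := (lie_derived L).
Local Notation N := (@normal_auts K L).
Local Notation gen := (@free_metab_nil_gen K m c).
Local Notation coorE := (coorD, coorZ, coor0, coor_vec).

(** The first three generators are sent to x1, x2 and e, the others to 0. *)
Definition test_gen (s t : K) (i : nat) : test_lie s t :=
  nth 0 [:: vec [:: 0; 1]; vec [:: 0; 0; 1]; vec [:: 1]] i.

Lemma free_metab_nil_test_morph (s t : K) :
  [\/ (4 <= c)%N, t = 0 /\ (3 <= c)%N | [/\ s = 0, t = 0 & (2 <= c)%N]] ->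
  exists F : L -> test_lie s t,
    lie_morphism F /\ forall i, F (gen i) = test_gen s t i.
Proof.
have [cl4 cl3 cl2] := test_nilpotent s t => hc.
apply: (free_metab_nil_lift (fun i => test_gen s t i)); first exact: test_metabelian.
by case: hc => [c4|[t0 c3]|[s0 t0 c2]];
  [apply: subset_trans cl4|apply: subset_trans (cl3 t0)|apply: subset_trans (cl2 s0 t0)];
  apply: lie_lcs_le.
Qed.

Lemma test_morph_derived s t (F : L -> test_lie s t) u : lie_morphism F -> D u ->
  [/\ (F u)^[0] = 0, (F u)^[1] = 0 & (F u)^[2] = 0].
Proof. by move=> FM /(lie_lcs_preimage FM (k := 2)) /test_derived_sub. Qed.

Lemma gen_not_derived (i : 'I_m) : (2 <= c)%N -> i = 0%N :> nat -> ~ D (gen i).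
Proof.
move=> c2 i0 Di; have [|F [FM Fg]] := @free_metab_nil_test_morph 0 0; first by constructor 3.
have [_ + _] := test_morph_derived FM Di.
by rewrite Fg i0 coor_vec => /eqP; rewrite oner_eq0.
Qed.

Lemma test_morph_scalar s t (F : L -> test_lie s t) (f : lie_aut L) a x :
  lie_morphism F -> D (f x - a *: x) ->
  [/\ (F (f x))^[0] = a * (F x)^[0], (F (f x))^[1] = a * (F x)^[1]
    & (F (f x))^[2] = a * (F x)^[2]].
Proof.
move=> FM /(test_morph_derived FM); set d := F _ => -[d0 d1 d2].
have -> : F (f x) = d + a *: F x.
  by rewrite -(lie_morphZ FM) -(lie_morphD FM) subrK.
by rewrite !coorE d0 d1 d2 !add0r.
Qed.

(** The images of y2 and [y0, y1] are the central elements e and z of degrees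
    1 and 2. On them and on their sum f acts by scalars; comparing coordinates
    gives a = a^2. *)
Lemma normal_aut_scalar_rank3 (f : lie_aut L) a :
  (3 <= m)%N -> (2 <= c)%N -> N f -> a != 0 ->
  (forall x, D (f x - a *: x)) -> a = 1.
Proof.
move=> m3 c2 Nf a0 fa; have fM := lie_aut_morph f.
have [|F [FM Fg]] := @free_metab_nil_test_morph 0 0; first by constructor 3.
pose y0 := gen (Ordinal (ltnW (ltnW m3))).
pose y1 := gen (Ordinal (ltnW m3)).
pose y2 := gen (Ordinal m3); pose z := [lie y0, y1].
have Fy0 : F y0 = vec [:: 0; 1] by apply: Fg.
have Fy1 : F y1 = vec [:: 0; 0; 1] by apply: Fg.
have Fy2 : F y2 = vec [:: 1] by apply: Fg.
have Fz : F z = vec [:: 0; 0; 0; 1].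
  rewrite FM.2 Fy0 Fy1; apply: test_lie_eq; split; rewrite test_bracketE !coorE /=; ring.
have cen2 v : [lie F y2, v] = 0.
  by rewrite Fy2; apply: test_lie_eq; split; rewrite test_bracketE !coorE /=; ring.
have cen v : [lie F (y2 + z), v] = 0.
  rewrite (lie_morphD FM) Fy2 Fz.
  by apply: test_lie_eq; split; rewrite test_bracketE !coorE /=; ring.
have [b fy2] := normal_aut_central FM Nf cen2.
have [d fyz] := normal_aut_central FM Nf cen.
have [_ p1 p2] := test_morph_scalar FM (fa y0).
have [_ q1 q2] := test_morph_scalar FM (fa y1).
have [r0 _ _] := test_morph_scalar FM (fa y2).
move: fyz r0; rewrite (lie_morphD fM) !(lie_morphD FM) fM.2 FM.2 fy2 Fy2 Fz => fyz.
rewrite !coorE /= !mulr1 => ba.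
have := congr1 (fun p : test_lie 0 0 => p^[0]) fyz.
have := congr1 (fun p : test_lie 0 0 => p^[3]) fyz.
rewrite test_bracketE !coorE /= p1 p2 q1 q2 Fy0 Fy1 !coorE /= ba.
rewrite !(mulr0, mulr1, addr0, add0r, subr0) => aa ad.
by apply: (mulfI a0); rewrite mulr1 aa ad.
Qed.

(** The images of [y0,y1,y0] and [y0,y1,y1,y1] are the central elements u and
    w of degrees 3 and 4; comparing coordinates gives a^3 = a^4. *)
Lemma normal_aut_scalar_class4 (f : lie_aut L) a :
  (2 <= m)%N -> (4 <= c)%N -> N f -> a != 0 ->
  (forall x, D (f x - a *: x)) -> a = 1.
Proof.
move=> m2 c4 Nf a0 fa; have fM := lie_aut_morph f.
have [|F [FM Fg]] := @free_metab_nil_test_morph 1 1; first by constructor 1.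
pose y0 := gen (Ordinal (ltnW m2)); pose y1 := gen (Ordinal m2).
pose z := [lie y0, y1]; pose u := [lie z, y0]; pose w := [lie [lie z, y1], y1].
have Fy0 : F y0 = vec [:: 0; 1] by apply: Fg.
have Fy1 : F y1 = vec [:: 0; 0; 1] by apply: Fg.
have Fz : F z = vec [:: 0; 0; 0; 1].
  by rewrite FM.2 Fy0 Fy1; apply: test_lie_eq; split; rewrite test_bracketE !coorE /=; ring.
have Fu : F u = vec [:: 0; 0; 0; 0; 1].
  by rewrite FM.2 Fz Fy0; apply: test_lie_eq; split; rewrite test_bracketE !coorE /=; ring.
have Fv : F [lie z, y1] = vec [:: 0; 0; 0; 0; 0; 1].
  by rewrite FM.2 Fz Fy1; apply: test_lie_eq; split; rewrite test_bracketE !coorE /=; ring.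
have Fw : F w = vec [:: 0; 0; 0; 0; 0; 0; 1].
  by rewrite FM.2 Fv Fy1; apply: test_lie_eq; split; rewrite test_bracketE !coorE /=; ring.
have cenu v : [lie F u, v] = 0.
  by rewrite Fu; apply: test_lie_eq; split; rewrite test_bracketE !coorE /=; ring.
have cenw v : [lie F w, v] = 0.
  by rewrite Fw; apply: test_lie_eq; split; rewrite test_bracketE !coorE /=; ring.
have cen v : [lie F (u + w), v] = 0.
  by rewrite (lie_morphD FM) lieDl cenu cenw addr0.
have [b fu] := normal_aut_central FM Nf cenu.
have [e fw] := normal_aut_central FM Nf cenw.
have [d fuw] := normal_aut_central FM Nf cen.
have [_ p1 p2] := test_morph_scalar FM (fa y0).
have [_ q1 q2] := test_morph_scalar FM (fa y1).
move: p1 p2 q1 q2; rewrite Fy0 Fy1 !coorE /= !(mulr0, mulr1) => p1 p2 q1 q2.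
have [z1 z2 z3] : [/\ (F (f z))^[1] = 0, (F (f z))^[2] = 0 & (F (f z))^[3] = a ^+ 2].
  rewrite fM.2 FM.2 test_bracketE !coor_vec /= p1 p2 q1 q2; split=> //; ring.
have [v2 v5] : (F (f [lie z, y1]))^[2] = 0 /\ (F (f [lie z, y1]))^[5] = a ^+ 3.
  rewrite fM.2 FM.2 test_bracketE !coor_vec /= z2 z3 q2; split=> //; ring.
have bE : b = a ^+ 3.
  have -> : b = (F (f u))^[4] by rewrite fu Fu !coorE mulr1.
  rewrite fM.2 FM.2 test_bracketE coor_vec /= z1 z3 p1; ring.
have eE : e = a ^+ 4.
  have -> : e = (F (f w))^[6] by rewrite fw Fw !coorE mulr1.
  rewrite fM.2 FM.2 test_bracketE coor_vec /= v2 v5 q2; ring.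
move: fuw; rewrite (lie_morphD fM) !(lie_morphD FM) fu fw Fu Fw => fuw.
have := congr1 (fun p : test_lie 1 1 => p^[4]) fuw.
have := congr1 (fun p : test_lie 1 1 => p^[6]) fuw.
rewrite !coorE /= !(mulr0, mulr1, addr0, add0r) => ed bd.
by apply: (mulfI (expf_neq0 3 a0)); rewrite mulr1 -exprSr -bE -eE ed bd.
Qed.

(** The image in the algebra with s = 1 and t = 0 is the basis vector u. *)
Lemma free_metab_nil_bracket_neq0 (i j : 'I_m) :
  (3 <= c)%N -> i = 0%N :> nat -> j = 1%N :> nat ->
  [lie [lie gen i, gen j], gen i] != 0.
Proof.
move=> c3 i0 j1; have [|F [FM Fg]] := @free_metab_nil_test_morph 1 0; first by constructor 2.
apply: contra_neq (oner_neq0 K) => /(congr1 F) /(congr1 (fun p : test_lie 1 0 => p^[4])).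
rewrite (lie_morph0 FM) !FM.2 !Fg i0 j1 !test_bracketE !coorE /= => <-; ring.
Qed.

Lemma normal_aut_IA (f : lie_aut L) x :
  (3 <= m)%N && (2 <= c)%N || (2 <= m)%N && (4 <= c)%N -> N f -> D (f x - x).
Proof.
move=> mc Nf.
have m0 : (0 < m)%N by case/orP: mc => /andP[m2 _]; apply: leq_trans m2.
have c2 : (1 < c)%N by case/orP: mc => /andP[_ c2]; apply: leq_trans c2.
have [a a0 fa] := normal_aut_scalar Nf (@gen_not_derived (Ordinal m0) c2 erefl).
suff a1 : a = 1 by have := fa x; rewrite a1 scale1r.
case/orP: mc => /andP[hm hc].
  exact: (normal_aut_scalar_rank3 hm hc Nf a0 fa).
exact: (normal_aut_scalar_class4 hm hc Nf a0 fa).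
Qed.

End NormalAutomorphismsOfFree.

Lemma free_metab_nil3_noncommuting (K : fieldType) (m : nat) :
  (2 <= m)%N -> (2%:R : K)%R != 0%R ->
  exists f g, [/\ normal_auts (free_metab_nil K m 3) f,
    normal_auts (free_metab_nil K m 3) g & (f * g)%g <> (g * f)%g].
Proof.
move=> m2 two0.
have met := @free_metab_nil_metabelian K m 3.
have cl3 (u x : free_metab_nil K m 3) : lie_lcs _ 3 u -> lie u x = 0%R.
  by move=> /(mem_lie_lcs (k := 2) x) /free_metab_nil_class.
pose y0 := free_metab_nil_gen K 3 (Ordinal (ltnW m2)).
pose y1 := free_metab_nil_gen K 3 (Ordinal m2).
exists (LieAut (asboolT (lie_exp_aut met cl3 y0 two0))).
exists (LieAut (asboolT (lie_exp_aut met cl3 y1 two0))).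
split; [exact: lie_exp_normal|exact: lie_exp_normal|].
move/(congr1 (fun f => aut_fun f y0)) => /(lie_exp_comm cl3) /eqP.
by apply/negP; apply: free_metab_nil_bracket_neq0.
Qed.

Theorem theorem3p6 (K : fieldType) (charK : [pchar K]%R =i pred0) :
  [/\ forall m : nat, 3 <= m ->
        grp_abelian (normal_auts (free_metab_nil K m 2)),
      forall m : nat, 3 <= m ->
        grp_nilpotent_class (normal_auts (free_metab_nil K m 3)) 2,
      forall m c : nat, (2 <= m /\ 4 <= c) \/ (m, c) = (2, 2) ->
        grp_metabelian (normal_auts (free_metab_nil K m c))
    & grp_nil2_by_abelian (normal_auts (free_metab_nil K 2 3))].
Proof.
have two0 : (2%:R : K)%R != 0%R by rewrite ((pcharf0P K).1 charK).
have central m c (u x : free_metab_nil K m c.+1) :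
    lie_lcs _ c.+1 u -> lie u x = 0%R.
  by move=> /(mem_lie_lcs x) /free_metab_nil_class.
split.
- move=> m m3; apply: class2_IA_abelian => [|f x].
    exact: (central m 1).
  by apply: normal_aut_IA; rewrite m3.
- move=> m m3.
  have [f [g [Nf Ng nfg]]] := free_metab_nil3_noncommuting (ltnW m3) two0.
  apply: grp_nilpotent_class2 Nf Ng nfg.
  have -> : normal_auts (free_metab_nil K m 3) = normal_fix setT (lie_derived _).
    apply/seteqP; split=> [f' Nf'|f' []//]; split=> // x _.
    by apply: normal_aut_IA => //; rewrite m3.
  apply: class3_IA_nilpotent; first exact: free_metab_nil_metabelian.
  exact: (central m 2).
- move=> m c [[m2 c4]|[-> ->]]; apply: normal_auts_metabelian => f g u Nf Ng Du.
    have IA (h : lie_aut (free_metab_nil K m c)) x :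
        normal_auts _ h -> lie_derived _ (h x - x)%R.
      by apply: normal_aut_IA; rewrite m2 c4 orbT.
    apply: normal_IA_comm => //; first exact: free_metab_nil_metabelian.
      by move=> x; apply: IA.
    by move=> x; apply: IA.
  by apply: class2_normal_comm => //; apply: (central 2 1).
- exists (normal_fix setT (lie_derived _)).
  have nD := normal_fix_normal (is_lie_idealT _) (lie_derived_ideal (free_metab_nil K 2 3)).
  split=> //.
    apply: class3_IA_nilpotent; first exact: free_metab_nil_metabelian.
    exact: (central 2 2).
  apply: grp_quotient_abelian_commg => // f g Nf Ng.
  apply: normal_fix_commg => // [|x _]; first exact: lie_derived_ideal.
  exact: normal_auts_comm_mod.
Qed.
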